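(* Let $H$ be a complex Hilbert space and $T\in\mathcal{B}(H)$. The following assertions are equivalent: (i) $T$ is normaloid; (ii) $\|T\|\le\|XTX^{-1}\|$ for all invertible $X\in\mathcal{B}(H)$.
   Context: $H$ is a complex Hilbert space and $\mathcal{B}(H)$ is the space of bounded linear operators on $H$ with the operator norm $\|\cdot\|$. An operator $T$ is normaloid if $r(T)=\|T\|$, where $r(T)$ is the spectral radius of $T$. *)

(* Defs.v *)
From HB Require Import structures.
From mathcomp Require Import all_boot all_order all_algebra.
From mathcomp Require Import complex.
From mathcomp Require Import all_classical all_reals all_analysis.

Set Implicit Arguments.
Unset Strict Implicit.
Unset Printing Implicit Defensive.

Import Order.TTheory GRing.Theory Num.Theory.
Import numFieldNormedType.Exports.

Local Open Scope classical_set_scope.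
Local Open Scope ring_scope.

(* In a normed module over R[i] the norm `|x| is an element of R[i] (with zero
   imaginary part); Renorm is the same number in R, where suprema are taken. *)
Definition Renorm (R : realType) (V : normedModType R[i]) (x : V) : R :=
  complex.Re `|x|.

(* A complex Hilbert space is a completeNormedModType over R[i] together with
   an inner product inducing its norm. *)
Definition induces_norm (R : realType) (H : normedModType R[i])
    (ip : {dot H for Num.conj}) : Prop :=
  forall x : H, `|x| ^+ 2 = ip x x.

Section Operators.
Context (R : realType) (H : normedModType R[i]).

Definition bounded_op (T : {linear H -> H}) : Prop :=
  exists M : R, forall x : H, Renorm (T x) <= M * Renorm x.

Definition opnorm (T : {linear H -> H}) : R :=
  sup [set Renorm (T x) | x in [set x : H | Renorm x <= 1]].

(* Y is the inverse of X in the algebra of bounded operators. *)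
Definition op_inverse (X Y : {linear H -> H}) : Prop :=
  [/\ bounded_op X, bounded_op Y, cancel X Y & cancel Y X].

Definition op_invertible (X : {linear H -> H}) : Prop :=
  exists Y : {linear H -> H}, op_inverse X Y.

Definition spectrum (T : {linear H -> H}) : set R[i] :=
  [set l : R[i] | ~ op_invertible (T \- l \*: idfun)].

(* If H = 0 the spectrum is empty and, as sup set0 = 0, the radius is 0. *)
Definition spectral_radius (T : {linear H -> H}) : R :=
  sup [set complex.Re `|l| | l in spectrum T].

Definition normaloid (T : {linear H -> H}) : Prop :=
  spectral_radius T = opnorm T.

End Operators.

(* Main.v *)
Require Import Defs.
From HB Require Import structures.
From mathcomp Require Import all_boot all_order all_algebra.
From mathcomp Require Import complex.
From mathcomp Require Import all_classical all_reals all_analysis.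
From mathcomp Require Import ring lra.

Set Implicit Arguments.
Unset Strict Implicit.
Unset Printing Implicit Defensive.

Import Order.TTheory GRing.Theory Num.Theory.
Import numFieldNormedType.Exports.

Local Open Scope ring_scope.

(* One direction holds because similar operators have the same spectrum and
   the spectral radius is at most the norm.

   For the converse let [r = ||T||] and suppose that the spectral radius is
   smaller than [r].  By compactness [T - l] is bounded below uniformly for
   [|l| = r].  If [||T^M|| > r^M / 2] for all [M], take [x] with
   [||T^M x|| > r^M ||x|| / 2]: all the vectors [r^-k T^k x], [k < M], have norm
   at least [||x|| / 2], and for some [|c| = 1] the vector
   [y = \sum_(k < M) c^k r^-k T^k x] has norm at least [sqrt M ||x|| / 2], while
   [(T - r c^-1) y] telescopes and has norm at most [2 r ||x||]; this is absurd
   for large [M].  So [||T^M|| <= r^M / 2] for some [M].  With [S = r^-1 T],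
   [B = \sum_(k < M) S*^k S^k] and [X = 1 + e B] for small [e > 0], the norm of
   [X T X^-1] is smaller than [r]: no square root of [B] is needed, since
   [X^2 = 1 + 2 e B] up to [e^2]. *)

Local Notation N := Renorm.
Local Notation cmod c := (complex.Re `|c|).

(** * Real-valued norm and modulus *)

Section Renorm.
Context (R : realType) (H : normedModType R[i]).
Implicit Types (x y : H) (c : R[i]).

Lemma normr_Renorm x : `|x| = (N x)%:C%C.
Proof.
rewrite /Renorm; have := normr_ge0 x; rewrite lecE /= => /andP[/eqP e _].
by case: `|x| e => a b /= ->.
Qed.

Lemma normr_cmod c : `|c| = (cmod c)%:C%C.
Proof. by rewrite normc_def. Qed.

Lemma Renorm_ge0 x : 0 <= N x.
Proof. by have := normr_ge0 x; rewrite lecE /= => /andP[]. Qed.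

Lemma cmod_ge0 c : 0 <= cmod c.
Proof. by rewrite normc_def /= sqrtr_ge0. Qed.

Lemma RenormD x y : N (x + y) <= N x + N y.
Proof. by have := ler_normD x y; rewrite !normr_Renorm -rmorphD lecR. Qed.

Lemma RenormZ c x : N (c *: x) = cmod c * N x.
Proof.
by apply: complexI; rewrite rmorphM /= -normr_Renorm normrZ normr_Renorm -normr_cmod.
Qed.

Lemma cmodM c d : cmod (c * d) = cmod c * cmod d.
Proof. by apply: complexI; rewrite rmorphM /= -!normr_cmod normrM. Qed.

Lemma cmod_real (a : R) : cmod (a%:C%C) = `|a|.
Proof. by rewrite normc_def /= expr0n addr0 sqrtr_sqr. Qed.

Lemma cmod_eq0 c : (cmod c == 0) = (c == 0).
Proof. by rewrite -(normr_eq0 c) normr_cmod -(inj_eq (@complexI R)). Qed.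

Lemma cmod_gt0 c : (0 < cmod c) = (c != 0).
Proof. by rewrite lt_def cmod_eq0 cmod_ge0 andbT. Qed.

Lemma cmodV c : cmod c^-1 = (cmod c)^-1.
Proof. by apply: complexI; rewrite fmorphV /= -!normr_cmod normfV. Qed.

Lemma Renorm_eq0 x : (N x == 0) = (x == 0).
Proof. by rewrite -(normr_eq0 x) normr_Renorm -(inj_eq (@complexI R)). Qed.

Lemma Renorm0 : N (0 : H) = 0.
Proof. by rewrite /Renorm normr0. Qed.

Lemma RenormN x : N (- x) = N x.
Proof. by rewrite /Renorm normrN. Qed.

Lemma RenormB x y : N x - N y <= N (x - y).
Proof. by have := RenormD (x - y) y; rewrite subrK; lra. Qed.

End Renorm.

Lemma Renorm_complete (R : realType) (H : completeNormedModType R[i])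
    (u : nat -> H) :
  (forall e : R, 0 < e -> exists n0, forall m n, (n0 <= m)%N -> (n0 <= n)%N ->
    N (u m - u n) < e) ->
  exists l, forall e : R, 0 < e -> exists n0, forall n, (n0 <= n)%N ->
    N (u n - l) < e.
Proof.
move=> uc; have ucv : cvg (u @ \oo)%classic.
  apply/cauchy_cvgP/cauchy_exP => e e0.
  (* A positive element of [R[i]] is real, so real radii suffice. *)
  have [/eqP Ie Re0] : complex.Im e == 0 /\ 0 < complex.Re e.
    by move: e0; rewrite ltcE /= => /andP[/eqP -> ?].
  have [n0 hn] := uc _ Re0.
  exists (u n0); exists n0 => // n /= hn0.
  rewrite -ball_normE /ball_ /= normr_Renorm.
  have -> : e = (complex.Re e)%:C%C by case: (e) Ie => a b /= ->.
  by rewrite ltcR; apply: hn.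
exists (lim (u @ \oo)%classic) => e e0.
have /cvgrPdist_lt/(_ e%:C%C) := ucv.
rewrite ltcR => /(_ e0) [n0 _ hn]; exists n0 => n hn0.
have := hn n hn0; rewrite /= distrC normr_Renorm ltcR; exact.
Qed.

(** * Bounded operators and their inverses *)

Section Bounded.
Context (R : realType) (H : normedModType R[i]).
Implicit Types (x y z : H) (c : R[i]) (T S L : {linear H -> H}).

Lemma linear_pack (f : H -> H) :
  linear f -> exists L : {linear H -> H}, L =1 f.
Proof.
move=> lf; pose m := GRing.isLinear.Build _ _ _ _ f lf.
pose L : {linear H -> H} := HB.pack f m.
by exists L.
Qed.

(** The lower bound forces injectivity, so the preimages picked by choice are unique. Uniqueness
    makes the chosen inverse linear, and the same bound controls its norm. *)
Lemma linear_inverse L (K : R) :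
  (forall z, exists y, L y = z) -> (forall y, N y <= K * N (L y)) ->
  exists Y : {linear H -> H},
    [/\ cancel L Y, cancel Y L & forall z, N (Y z) <= K * N z].
Proof.
move=> /choice [f fK] bL.
have Linj : injective L.
  move=> x y /eqP; rewrite -subr_eq0 -linearB => /eqP e.
  apply/eqP; rewrite -subr_eq0 -Renorm_eq0 eq_le Renorm_ge0 andbT.
  by apply: le_trans (bL _) _; rewrite e Renorm0 ?mulr0.
have [|Y Yf] := @linear_pack f.
  by move=> c x y; apply: Linj; rewrite linearP !fK.
exists Y; split => [x|z|z]; rewrite Yf ?fK //.
  by apply: Linj; rewrite fK.
by apply: le_trans (bL _) _; rewrite fK.
Qed.

Lemma opnorm_le T (M : R) :
  0 <= M -> (forall x, N (T x) <= M * N x) -> opnorm T <= M.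
Proof.
move=> M0 bT; apply: ge_sup.
  by exists (N (T 0)), 0 => //=; rewrite Renorm0 ?ler01.
move=> _ [x /= x1 <-]; apply: le_trans (bT x) _.
by rewrite -[leRHS]mulr1 ler_wpM2l.
Qed.

Lemma has_sup_opnorm T : bounded_op T ->
  has_sup [set N (T x) | x in [set x : H | N x <= 1]]%classic.
Proof.
move=> [M bT]; split.
  by exists (N (T 0)), 0 => //=; rewrite Renorm0 ?ler01.
exists `|M| => _ [x /= x1 <-]; apply: le_trans (bT x) _.
apply: le_trans (ler_wpM2r (Renorm_ge0 _) (ler_norm M)) _.
by rewrite -[leRHS]mulr1 ler_wpM2l.
Qed.

Lemma opnorm_ge0 T : bounded_op T -> 0 <= opnorm T.
Proof.
move=> bT; apply: sup_upper_bound; first exact: has_sup_opnorm.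
by exists 0; rewrite /= ?linear0 Renorm0 ?ler01.
Qed.

Lemma opnormP T : bounded_op T -> forall x, N (T x) <= opnorm T * N x.
Proof.
move=> bT x; have [->|x0] := eqVneq x 0.
  by rewrite linear0 Renorm0 ?mulr0.
have Nx : 0 < N x by rewrite lt_def Renorm_eq0 x0 Renorm_ge0.
have Nxi : cmod ((N x)^-1)%:C%C = (N x)^-1.
  by rewrite cmod_real ger0_norm // invr_ge0 ltW.
rewrite -ler_pdivrMr //.
have -> : N (T x) / N x = N (T (((N x)^-1)%:C%C *: x)).
  by rewrite linearZ /= RenormZ Nxi mulrC.
apply: sup_upper_bound; first exact: has_sup_opnorm.
by eexists; last reflexivity; rewrite /= RenormZ Nxi mulVf // gt_eqF.
Qed.

Lemma bounded_comp T S : bounded_op T -> bounded_op S -> bounded_op (T \o S).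
Proof.
move=> bT bS; exists (opnorm T * opnorm S) => x /=.
apply: le_trans (opnormP bT _) _; rewrite -mulrA.
by apply: ler_wpM2l; [exact: opnorm_ge0 | exact: opnormP].
Qed.

Lemma bounded_subZ T c : bounded_op T -> bounded_op (T \- c \*: idfun).
Proof.
move=> bT; exists (opnorm T + cmod c) => x /=.
rewrite mulrDl -RenormZ -(RenormN (c *: x)).
by apply: le_trans (RenormD _ _) _; rewrite lerD2r; exact: opnormP.
Qed.

Lemma op_invertible_inverse L (K : R) : bounded_op L ->
  (forall z, exists y, L y = z) -> (forall y, N y <= K * N (L y)) ->
  op_invertible L.
Proof.
move=> bL sL lL; have [Y [LY YL bY]] := linear_inverse sL lL.
by exists Y; split => //; exists K.
Qed.

Lemma op_invertible_bounded_below L : op_invertible L ->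
  exists2 K : R, 0 < K & forall y, N y <= K * N (L y).
Proof.
(* The added 1 keeps the constant positive when [opnorm Y] is 0, as happens on the zero space. *)
move=> [Y [_ bY LY _]]; exists (opnorm Y + 1).
  by have := opnorm_ge0 bY; lra.
move=> y; rewrite -{1}(LY y); apply: le_trans (opnormP bY _) _.
by rewrite ler_wpM2r ?Renorm_ge0 // lerDl ler01.
Qed.

End Bounded.

(** * Neumann series and elementary spectral theory *)

Section Neumann.
Context (R : realType) (H : completeNormedModType R[i]).
Implicit Types (x y z : H) (c : R[i]) (T S L : {linear H -> H}).

(** The iterates of [y |-> z + T y] from 0 are the partial sums of the Neumann series; they are
    Cauchy and their limit is a fixed point. *)
Lemma neumann_surjective T (q : R) : 0 <= q < 1 ->
  (forall x, N (T x) <= q * N x) -> forall z, exists y, y - T y = z.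
Proof.
move=> /andP[q0 q1] bT z.
(* [D] solves [D = N z + q * D], so the bound [N (u k) <= D] reproduces itself. *)
pose u n := iter n (fun y => z + T y) 0; pose D := N z / (1 - q).
have q1' : 0 < 1 - q by rewrite subr_gt0.
have D0 : 0 <= D by rewrite divr_ge0 ?Renorm_ge0 // ltW.
have uD k : N (u k) <= D.
  elim: k => [|k IH]; first by rewrite /u /= Renorm0.
  have -> : D = N z + q * D by rewrite /D; field; rewrite gt_eqF.
  apply: le_trans (RenormD _ _) _; rewrite lerD2l.
  by apply: le_trans (bT _) _; exact: ler_wpM2l.
have du n k : N (u (n + k)%N - u n) <= q ^+ n * D.
  elim: n => [|n IH]; first by rewrite subr0 expr0 mul1r uD.
  rewrite addSn /= opprD addrACA subrr add0r -linearB exprS -mulrA.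
  by apply: le_trans (bT _) _; exact: ler_wpM2l.
have small (e : R) : 0 < e -> exists n0, q ^+ n0 * (D + D) < e.
  move=> e0; have D2 : 0 < D + D + 1 by lra.
  have : ((fun n => q ^+ n) @ \oo --> (0 : R))%classic.
    by apply: cvg_expr; rewrite ger0_norm.
  move=> /cvgrPdist_lt/(_ (e / (D + D + 1))); rewrite divr_gt0 // => /(_ isT).
  move=> [n0 _ /(_ n0 (leqnn n0))] /=; rewrite sub0r normrN ger0_norm ?exprn_ge0 //.
  rewrite ltr_pdivlMr // => h; exists n0; apply: le_lt_trans h.
  by rewrite ler_wpM2l ?exprn_ge0 // lerDl ler01.
have [|l hl] := @Renorm_complete R H u.
  move=> e /small [n0 hn0]; exists n0 => m n m0 n0'.
  apply: le_lt_trans hn0; rewrite mulrDr.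
  have -> : u m - u n = (u m - u n0) + - (u n - u n0).
    by rewrite opprB addrA subrK.
  apply: le_trans (RenormD _ _) _; rewrite RenormN.
  by apply: lerD; [rewrite -(subnKC m0)|rewrite -(subnKC n0')]; exact: du.
exists l; apply/eqP; rewrite -subr_eq0 -Renorm_eq0 eq_le Renorm_ge0 andbT.
apply/ler_addgt0Pl => e e0; rewrite addr0.
have [n1 h1] := hl (e / 2) (ltac:(lra)).
(* Since [u n1.+1 = z + T (u n1)], the defect of [l] is a difference of two small terms. *)
have -> : l - T l - z = (T (u n1) - T l) - (u n1.+1 - l).
  rewrite /= opprB addrCA opprD !addrA addrAC; congr (_ - _).
  by rewrite addrAC addrK.
apply: le_trans (RenormD _ _) _; rewrite RenormN -linearB.
have a := h1 _ (leqnn n1); have b := h1 _ (leqnSn n1).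
have := bT (u n1 - l); have := Renorm_ge0 (u n1 - l); nra.
Qed.

Lemma neumann_invertible T (q : R) : 0 <= q < 1 ->
  (forall x, N (T x) <= q * N x) -> op_invertible (idfun \- T).
Proof.
move=> hq bT; have /andP[q0 q1] := hq.
have bq : bounded_op T by exists q.
apply: (@op_invertible_inverse _ _ _ (1 - q)^-1).
- exists (1 + q) => x /=; have := RenormD x (- T x); rewrite RenormN.
  by have := bT x; lra.
- exact: neumann_surjective hq bT.
move=> y; rewrite ler_pdivlMl ?subr_gt0 //=.
by have := RenormB y (T y); have := bT y; lra.
Qed.

Lemma spectrum_le_opnorm T (l : R[i]) :
  bounded_op T -> spectrum T l -> cmod l <= opnorm T.
Proof.
move=> bT sl; rewrite leNgt; apply/negP => lt; apply: sl.
have nT := opnorm_ge0 bT.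
have l0 : l != 0 by rewrite -cmod_gt0; lra.
have cl : 0 < cmod l by rewrite cmod_gt0.
apply: (@op_invertible_inverse _ _ _ (cmod l - opnorm T)^-1).
- exact: bounded_subZ.
- move=> z.
  (* Factor [T - l] as [- l * (1 - l^-1 T)]; the second factor is handled by the Neumann series
     because [opnorm T < cmod l]. *)
  have [||y hy] := @neumann_surjective (l^-1 \*: T) (opnorm T / cmod l) _ _ (- l^-1 *: z).
  + by apply/andP; split; [exact: divr_ge0 nT (ltW cl) | rewrite ltr_pdivrMr // mul1r].
  + move=> x /=; rewrite RenormZ cmodV mulrC mulrAC ler_pM2r ?invr_gt0 //.
    exact: opnormP.
  exists y; move/(congr1 (fun v => - l *: v)): hy => /=.
  by rewrite scalerBr !scalerA mulNr mulfV // scaleNr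
    scaleN1r opprK mulNr mulrN opprK mulfV // scale1r addrC.
move=> y; rewrite ler_pdivlMl ?subr_gt0 //=.
rewrite -(RenormN (T y - _)) opprB mulrBl -RenormZ.
by have := RenormB (l *: y) (T y); have := opnormP bT y; lra.
Qed.

Lemma spectral_radius_le_opnorm T : bounded_op T ->
  spectral_radius T <= opnorm T.
Proof.
move=> bT; rewrite /spectral_radius.
have [->|/set0P e] := eqVneq [set cmod l | l in spectrum T]%classic set0.
  by rewrite sup0 opnorm_ge0.
by apply: ge_sup => // _ [l sl <-]; exact: spectrum_le_opnorm.
Qed.

Lemma le_spectral_radius T (l : R[i]) : bounded_op T ->
  spectrum T l -> cmod l <= spectral_radius T.
Proof.
move=> bT sl; apply: sup_upper_bound; last by exists l.
split; first by exists (cmod l), l.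
by exists (opnorm T) => _ [m sm <-]; exact: spectrum_le_opnorm.
Qed.

Lemma spectral_radius_ge0 T : bounded_op T -> 0 <= spectral_radius T.
Proof.
move=> bT; rewrite /spectral_radius.
have [->|/set0P [_ [l sl _]]] := eqVneq [set cmod l | l in spectrum T]%classic set0.
  by rewrite sup0.
by apply: le_trans (cmod_ge0 l) _; exact: le_spectral_radius.
Qed.

(** If [Z] inverts [X T Y - l], then [Y Z X] inverts [T - l]. *)
Lemma similar_spectrum T X Y : bounded_op T -> op_inverse X Y ->
  (spectrum T `<=` spectrum (X \o T \o Y))%classic.
Proof.
move=> bT [bX bY XY YX] l sl [Z [_ bZ SZ ZS]]; apply: sl.
exists (Y \o Z \o X); split.
- exact: bounded_subZ.
- by apply: bounded_comp => //; exact: bounded_comp.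
- move=> x /=; have := SZ (X x).
  by rewrite /= XY -(linearZ_LR X) -(linearB X) => ->; rewrite XY.
- move=> x /=; have := ZS (X x).
  rewrite /= -{2}(YX (Z (X x))) -(linearZ_LR X) -(linearB X).
  exact: (can_inj XY).
Qed.

End Neumann.

(** * Real part of the inner product and twisted sums *)

Section InnerProduct.
Context (R : realType) (H : normedModType R[i]) (ip : {dot H for Num.conj}).
Hypothesis ipH : induces_norm ip.
Implicit Types (x y z : H) (c : R[i]).
Local Notation g x y := (complex.Re (ip x y)).

Lemma Re_conj c : complex.Re (Num.conj c) = complex.Re c.
Proof. by case: c. Qed.

Lemma RenormE x : N x ^+ 2 = g x x.
Proof. by rewrite -(ipH x) normr_Renorm expr2 /= mulr0 subr0. Qed.

Lemma sqr_RenormD x y : N (x + y) ^+ 2 = N x ^+ 2 + N y ^+ 2 + 2 * g x y.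
Proof.
rewrite !RenormE dnormD !raddfD /= mulr_natl mulr2n; congr (_ + (_ + _)).
by rewrite Re_conj.
Qed.

Lemma ReipC x y : g x y = g y x.
Proof. rewrite [ip x y]hermC mul1r; exact: Re_conj. Qed.

Lemma ReipZr (a : R) x y : g x (a%:C%C *: y) = a * g x y.
Proof.
rewrite linearZr_LR /=; case: (ip x y) => b d.
by rewrite /= oppr0 mul0r subr0.
Qed.

Lemma ReipNr x y : g x (- y) = - g x y.
Proof. by rewrite linearNr raddfN. Qed.

Lemma ReipDr x y z : g x (y + z) = g x y + g x z.
Proof. by rewrite linearDr raddfD. Qed.

Lemma ReipDl x y z : g (x + y) z = g x z + g y z.
Proof. by rewrite linearDl raddfD. Qed.

Lemma parallelogram x y :
  N (x + y) ^+ 2 + N (x - y) ^+ 2 = 2 * (N x ^+ 2 + N y ^+ 2).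
Proof. by rewrite !sqr_RenormD RenormN ReipNr; ring. Qed.

Lemma cauchy_schwarz x y : `|g x y| <= N x * N y.
Proof.
have half u v : g u v <= N u * N v.
  have [->|v0] := eqVneq v 0.
    by rewrite linear0r Renorm0 ?mulr0.
  have Nv : 0 < N v by rewrite lt_def Renorm_eq0 v0 Renorm_ge0.
  (* Expanding this square gives [2 N u N v (N u N v - g u v) >= 0]; the factor [N u N v] is
     cancelled when it is nonzero. *)
  have := sqr_ge0 (N ((N v)%:C%C *: u + - ((N u)%:C%C *: v))).
  rewrite sqr_RenormD RenormN !RenormZ !cmod_real !ger0_norm ?Renorm_ge0 //.
  rewrite ReipNr ReipZr ReipC ReipZr ReipC => h.
  have [u0|u0] := eqVneq (N u) 0; last first.
    have Nu : 0 < N u by rewrite lt_def u0 Renorm_ge0.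
    have : 0 <= (N u * N v) * (N u * N v - g u v) by nra.
    by rewrite pmulr_rge0 ?subr_ge0 // mulr_gt0.
  by move/eqP: u0; rewrite Renorm_eq0 => /eqP ->; rewrite linear0l mulr_ge0 ?Renorm_ge0.
rewrite ler_norml half andbT lerNl -ReipNr -(RenormN y); exact: half.
Qed.

(* Splitting the sum into two halves, the parallelogram law allows to choose
   the sign of the square root of [d]. *)
Lemma exists_unimodular_twist m (v : nat -> H) (d : R[i]) : cmod d = 1 ->
  exists c : R[i], [/\ cmod c = 1, c ^+ (2 ^ m) = d &
    \sum_(k < 2 ^ m) N (v k) ^+ 2 <= N (\sum_(k < 2 ^ m) c ^+ k *: v k) ^+ 2].
Proof.
elim: m v d => [|m IH] v d d1.
  by exists d; split => //; rewrite expn0 !big_ord1 expr0 scale1r.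
pose s := sqrtC d; have s2 : s ^+ 2 = d by exact: sqrtCK.
have s1 : cmod s = 1.
  have : cmod s ^+ 2 = 1 by rewrite expr2 -cmodM -expr2 s2.
  by move/eqP; rewrite expr2 -expr2 sqrp_eq1 ?cmod_ge0 // => /eqP.
(* [w t] folds the second half onto the first: if [c ^+ (2 ^ m) = t], twisting [w t] by [c] gives
   the full twisted sum of [v]. *)
pose w (t : R[i]) k := v k + t *: v (2 ^ m + k)%N.
have [t [t2 t1 hw]] : exists t, [/\ t ^+ 2 = d, cmod t = 1 &
    \sum_(k < 2 ^ m.+1) N (v k) ^+ 2 <= \sum_(k < 2 ^ m) N (w t k) ^+ 2].
  (* The two signs average to the total, so at least one of them reaches it. *)
  have par : \sum_(k < 2 ^ m) N (w s k) ^+ 2 + \sum_(k < 2 ^ m) N (w (- s) k) ^+ 2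
      = 2 * \sum_(k < 2 ^ m.+1) N (v k) ^+ 2.
    rewrite expnS mul2n -addnn big_split_ord /= -!big_split mulr_sumr.
    apply: eq_bigr => k _.
    by rewrite /w scaleNr /= parallelogram RenormZ s1 mul1r.
  have [le|lt] := lerP (\sum_(k < 2 ^ m.+1) N (v k) ^+ 2)
                       (\sum_(k < 2 ^ m) N (w s k) ^+ 2).
    by exists s.
  by exists (- s); rewrite sqrrN normrN; split => //; lra.
have [c [c1 ct hc]] := IH (w t) t t1.
exists c; split => //; first by rewrite expnSr exprM ct.
apply: le_trans hw (le_trans hc _).
rewrite expnS mul2n -addnn big_split_ord /= -big_split /=.
rewrite le_eqVlt; apply/orP; left; apply/eqP; congr (N _ ^+ 2).
by apply: eq_bigr => k _; rewrite /w scalerDr scalerA -ct -exprD addnC.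
Qed.

(** [T] shifts the orbit, so [T y] is [b^-1] times the same sum with indices moved by one; only the
    two end terms survive. *)
Lemma twisted_orbit_sum (T : {linear H -> H}) (b : R[i]) n x :
  b != 0 ->
  let y := \sum_(k < n) b ^+ k *: iter k T x in
  T y - b^-1 *: y = b^-1 *: (b ^+ n *: iter n T x - x).
Proof.
move=> b0; elim: n => [|n IH] /=.
  by rewrite big_ord0 linear0 scaler0 subr0 expr0 scale1r subrr scaler0.
rewrite big_ord_recr /= (linearD T) scalerDr opprD addrACA IH (linearZ_LR T).
have -> : b ^+ n *: T (iter n T x) = b^-1 *: (b ^+ n.+1 *: T (iter n T x)).
  by rewrite scalerA exprS mulKf.
by rewrite -scalerBr -scalerDr [X in _ *: X]addrC addrA subrK.
Qed.

End InnerProduct.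

(** * Uniform lower bounds on a circle *)

Lemma cmod_le_ReIm (R : realType) (c : R[i]) :
  cmod c <= `|complex.Re c| + `|complex.Im c|.
Proof.
rewrite normc_def /= -[leRHS]ger0_norm ?addr_ge0 // -sqrtr_sqr ler_sqrt ?sqr_ge0 //.
rewrite sqrrD !real_normK ?num_real // lerD2r lerDl.
by rewrite mulrn_wge0 // mulr_ge0.
Qed.

Lemma ReIm_le_cmod (R : realType) (c : R[i]) :
  `|complex.Re c| <= cmod c /\ `|complex.Im c| <= cmod c.
Proof.
rewrite normc_def /= -!sqrtr_sqr !ler_sqrt ?addr_ge0 ?sqr_ge0 //.
by rewrite lerDl lerDr !sqr_ge0.
Qed.

Lemma cmod_dist (R : realType) (c d : R[i]) : `|cmod c - cmod d| <= cmod (c - d).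
Proof.
rewrite ler_norml lerNl opprB (@RenormB R R[i]^o c d) andbT distrC.
exact: (@RenormB R R[i]^o d c).
Qed.

(** Each bound persists on a neighbourhood at the price of doubling the constant, and compactness
    leaves finitely many constants. *)
Lemma circle_uniform_bound (R : realType) (H : normedModType R[i])
    (T : {linear H -> H}) (r : R) :
  (forall l, cmod l = r -> op_invertible (T \- l \*: idfun)) ->
  exists2 K : R, 0 < K &
    forall l, cmod l = r -> forall y, N y <= K * N (T y - l *: y).
Proof.
move=> inv.
(* [P] is vacuous off the circle, so a square containing the circle can serve as the compact set. *)
pose P (k : nat) (p : R * R) := cmod (Complex p.1 p.2) = r ->
  forall y, N y <= k%:R * N (T y - Complex p.1 p.2 *: y).
have : compact (`[- r, r]%classic `*` `[- r, r]%classic : set (R * R)%type)%classic.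
  by apply: compact_setX; exact: segment_compact.
move/compact_near_coveringP => /(_ nat \oo%classic P _).
have local p : exists d : R, exists k0 : nat, 0 < d /\
    forall q : R * R, `|p.1 - q.1| < d -> `|p.2 - q.2| < d ->
    forall k, (k0 <= k)%N -> P k q.
  have dist (q : R * R) d : `|p.1 - q.1| < d -> `|p.2 - q.2| < d ->
      cmod (Complex q.1 q.2 - Complex p.1 p.2) < d + d.
    move=> h1 h2; apply: le_lt_trans (cmod_le_ReIm _) _ => /=.
    by rewrite ltrD // distrC.
  have [pr|pr] := eqVneq (cmod (Complex p.1 p.2)) r; last first.
    (* With half the distance to the circle in each coordinate, the neighbourhood misses the
       circle. *)
    exists (`|r - cmod (Complex p.1 p.2)| / 2), 0%N.
    split; first by rewrite divr_gt0 // normr_gt0 subr_eq0 eq_sym.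
    move=> q h1 h2 k _ qr; have := dist q _ h1 h2.
    rewrite -splitr ltNge => /negP h; case: h; rewrite -qr; exact: cmod_dist.
  have [K K0 hK] := op_invertible_bounded_below (inv _ pr).
  have d0 : 0 < (4 * K)^-1 by rewrite invr_gt0 mulr_gt0.
  (* The parameter moves by less than [(2 * K)^-1], so the perturbation costs at most half of [N y];
     absorbing it turns [K] into [2 * K]. *)
  exists (4 * K)^-1, (Num.bound (2 * K)); split => // q h1 h2 k kb qr y.
  have Kk : 2 * K <= k%:R.
    rewrite ltW //; apply: lt_le_trans (archi_boundP _) _; first by lra.
    by rewrite ler_nat.
  apply: le_trans (ler_wpM2r (Renorm_ge0 _) Kk).
  have hq := dist q _ h1 h2.
  have e : T y - Complex p.1 p.2 *: y =
      (T y - Complex q.1 q.2 *: y) + (Complex q.1 q.2 - Complex p.1 p.2) *: y.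
    by rewrite scalerBl addrA subrK.
  have := hK y; rewrite /= e => h.
  have h3 := RenormD (T y - Complex q.1 q.2 *: y)
    ((Complex q.1 q.2 - Complex p.1 p.2) *: y).
  rewrite RenormZ in h3.
  have h4 : K * (cmod (Complex q.1 q.2 - Complex p.1 p.2) * N y) <= 2^-1 * N y.
    rewrite mulrA; apply: ler_wpM2r; first exact: Renorm_ge0.
    apply: le_trans (ler_wpM2l (ltW K0) (ltW hq)) _.
    rewrite le_eqVlt; apply/orP; left; apply/eqP; field.
    by rewrite gt_eqF.
  have h5 := ler_wpM2l (ltW K0) h3.
  move: h h4 h5; rewrite mulrDr; lra.
case; last first.
  move=> k0 _ /(_ k0.+1 (leqnSn _)) hk.
  exists k0.+1%:R; first by rewrite ltr0n.
  move=> [a b] lr y; have := hk (a, b); apply => //.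
  have [] := ReIm_le_cmod (Complex a b); rewrite lr /= !ler_norml => h1 h2.
  by split; rewrite /= in_itv.
move=> p _; have [d [k0 [d0 hP]]] := local p.
exists (ball p d, [set k | (k0 <= k)%N]%classic).
  split; first exact: nbhsx_ballx.
  by exists k0.
by move=> [q k] [[h1 h2] kk]; exact: hP.
Qed.

(** * Decay of some power of [T] *)

Section PowerBound.
Context (R : realType) (H : normedModType R[i]) (ip : {dot H for Num.conj}).
Hypothesis ipH : induces_norm ip.
Implicit Types (x y z : H) (c : R[i]) (T : {linear H -> H}).

Lemma Renorm_iter T (r : R) n x : 0 <= r -> (forall x, N (T x) <= r * N x) ->
  N (iter n T x) <= r ^+ n * N x.
Proof.
move=> r0 bT; elim: n => [|n IH]; first by rewrite mul1r.
rewrite exprS -mulrA iterS; apply: le_trans (bT _) _.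
exact: ler_wpM2l.
Qed.

(* If the orbit of [x] kept half of its maximal size for [2 ^ m] steps, then a
   suitably twisted sum of that orbit would be an approximate eigenvector for
   an eigenvalue of modulus [r]. *)
Lemma power_bound T (r K : R) : 0 < r -> 0 < K ->
  (forall x, N (T x) <= r * N x) ->
  (forall l, cmod l = r -> forall y, N y <= K * N (T y - l *: y)) ->
  exists M, forall x, N (iter M T x) <= 2^-1 * r ^+ M * N x.
Proof.
move=> r0 K0 bT hK.
(* The final estimates give [M / 4 <= 4 * (K * r) ^+ 2], which this choice contradicts. *)
pose m := Num.bound (16 * (K * r) ^+ 2).
have mb : 16 * (K * r) ^+ 2 < (2 ^ m)%:R.
  apply: lt_trans (archi_boundP _) _; first by rewrite mulr_ge0 ?sqr_ge0.
  by rewrite ltr_nat ltn_expl.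
move: mb; set M := (2 ^ m)%N => mb; exists M => x; rewrite leNgt; apply/negP => big.
pose v k := (r ^- k)%:C%C *: iter k T x.
have Nv k : N (v k) = r ^- k * N (iter k T x).
  by rewrite RenormZ cmod_real ger0_norm // invr_ge0 exprn_ge0 // ltW.
have Nx : 0 < N x.
  have := Renorm_iter M x (ltW r0) bT => h.
  have rM : 0 < r ^+ M by rewrite exprn_gt0.
  rewrite lt_def Renorm_ge0 andbT; apply: contraTN (lt_le_trans big h) => /eqP ->.
  by rewrite !mulr0 ltxx.
(* The remaining [M - k] steps enlarge the norm by at most [r ^+ (M - k)], so a large norm at time
   [M] forces one at time [k]. *)
have vlow k : (k < M)%N -> 2^-1 * N x <= N (v k).
  move=> kM; rewrite Nv ler_pdivlMl ?exprn_gt0 //.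
  have := Renorm_iter (M - k) (iter k T x) (ltW r0) bT.
  rewrite -iterD subnK ?(ltnW kM) // => h.
  rewrite -(@ler_pM2l _ (r ^+ (M - k))) ?exprn_gt0 //; apply: le_trans h.
  by rewrite mulrA -exprD subnK ?(ltnW kM) // mulrA (mulrC _ 2^-1) ltW.
have [c [c1 cM hc]] :=
  exists_unimodular_twist ipH m v (d := 1) (ltac:(by rewrite normr1)).
(* This makes [b ^+ k *: iter k T x] equal to [c ^+ k *: v k], while [b^-1] has modulus [r]. *)
pose b := c * (r^-1)%:C%C.
have c0 : c != 0 by rewrite -cmod_gt0 c1.
have rC0 : (r^-1)%:C%C != 0 :> R[i]
  by rewrite -cmod_gt0 cmod_real normr_gt0 invr_eq0 gt_eqF.
have b0 : b != 0 by rewrite mulf_neq0.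
have cb : cmod b^-1 = r.
  by rewrite cmodV cmodM c1 mul1r cmod_real normfV invrK ger0_norm // ltW.
have := twisted_orbit_sum T M x b0; set y := \sum_(k < M) _ => /= hy.
have yE : y = \sum_(k < M) c ^+ k *: v k.
  apply: eq_bigr => k _; rewrite /v scalerA /b exprMn -rmorphXn.
  by rewrite exprVn.
have := hK _ cb y; rewrite hy RenormZ cb => up.
have up2 : N (b ^+ M *: iter M T x - x) <= 2 * N x.
  apply: le_trans (RenormD _ _) _; rewrite RenormN mulr_natl mulr2n lerD2r.
  rewrite /b exprMn cM mul1r RenormZ -rmorphXn cmod_real exprVn.
  rewrite ger0_norm ?invr_ge0 ?exprn_ge0 ?(ltW r0) // ler_pdivrMl ?exprn_gt0 //.
  exact: Renorm_iter (ltW r0) bT.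
have up3 : N y <= 2 * (K * r) * N x.
  apply: le_trans up _.
  have -> : 2 * (K * r) * N x = K * (r * (2 * N x)) by ring.
  by rewrite (ler_pM2l K0) (ler_pM2l r0).
have low : M%:R * (2^-1 * N x) ^+ 2 <= N y ^+ 2.
  rewrite yE; apply: le_trans hc.
  rewrite mulr_natl -[X in _ *+ X](card_ord M) -sumr_const.
  by apply: ler_sum => k _; rewrite lerXn2r ?nnegrE ?Renorm_ge0 ?mulr_ge0 ?vlow ?(ltW Nx).
have up4 : N y ^+ 2 <= (2 * (K * r) * N x) ^+ 2.
  by rewrite lerXn2r ?nnegrE ?Renorm_ge0 // !mulr_ge0 // ltW.
have := le_trans low up4; rewrite !exprMn => h.
have : M%:R * (N x ^+ 2) <= 16 * (K * r) ^+ 2 * N x ^+ 2 by rewrite exprMn; lra.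
by rewrite ler_pM2r ?exprn_gt0 // leNgt mb.
Qed.

End PowerBound.

(** * Riesz representation, adjoints and the improving similarity *)

Section Adjoint.
Context (R : realType) (H : completeNormedModType R[i]).
Context (ip : {dot H for Num.conj}) (ipH : induces_norm ip).
Implicit Types (x y z : H) (T S : {linear H -> H}).
Local Notation g x y := (complex.Re (ip x y)).

Lemma ReipZ (c : R[i]) x y : g (c *: x) y = g x (Num.conj c *: y).
Proof. by rewrite linearZr_LR linearZl_LR /= conjCK. Qed.

Lemma Reip_inj y z : (forall x, g x y = g x z) -> y = z.
Proof.
move=> e; apply/eqP; rewrite -subr_eq0 -Renorm_eq0 -sqrf_eq0 (RenormE ipH).
by rewrite ReipDr ReipNr e subrr.
Qed.

(* The representing vector minimises [N x ^+ 2 - 2 * phi x]. *)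
Lemma riesz_representation (phi : H -> R) (M : R) :
  {morph phi : x y / x + y} ->
  (forall (a : R) x, phi (a%:C%C *: x) = a * phi x) ->
  (forall x, `|phi x| <= M * N x) ->
  exists z, forall x, g x z = phi x.
Proof.
move=> phiD phiZ bphi.
pose J x := N x ^+ 2 - 2 * phi x.
pose E := [set J x | x in [set: H]]%classic.
have Elb : has_lbound E.
  exists (- M ^+ 2) => _ [x _ <-]; rewrite /J.
  have := bphi x; rewrite ler_norml => /andP[_ h].
  have := sqr_ge0 (N x - M); nra.
have Einf : has_inf E by split => //; exists (J 0), 0.
have infJ x : inf E <= J x by apply: ge_inf => //; exists x.
have /choice [u hu] n : exists x, J x < inf E + n.+1%:R^-1.
  have [|_ [x _ <-] hx] := inf_adherent _ Einf (eps := n.+1%:R^-1).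
    by rewrite invr_gt0 ltr0n.
  by exists x.
(* Midpoints also have [J] at least [inf E], so this identity makes a minimising sequence Cauchy. *)
have JD x y : N (x - y) ^+ 2 = 2 * J x + 2 * J y - 4 * J ((2^-1)%:C%C *: (x + y)).
  have := parallelogram ipH x y.
  rewrite /J RenormZ cmod_real phiZ phiD ger0_norm ?invr_ge0 // exprMn.
  move=> h; have -> : N (x - y) ^+ 2 = 2 * (N x ^+ 2 + N y ^+ 2) - N (x + y) ^+ 2.
    by rewrite -h [X in _ = X - _]addrC addrK.
  by field.
have small (e : R) : 0 < e -> exists n0, forall n, (n0 <= n)%N -> n.+1%:R^-1 < e :> R.
  move=> e0; exists (Num.bound e^-1) => n hn.
  rewrite invf_plt ?posrE ?ltr0n //; apply: lt_le_trans (archi_boundP _) _.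
    by rewrite invr_ge0 ltW.
  by rewrite ler_nat ltnW.
have [|z hz] := @Renorm_complete R H u.
  (* Two gaps below [e ^+ 2 / 4] enter [JD] with factor 2 each, giving [e ^+ 2]. *)
  move=> e e0; have [|n0 hn0] := small (e ^+ 2 / 4); first by rewrite divr_gt0 ?exprn_gt0.
  exists n0 => m n hm hn.
  rewrite -(@ltr_pXn2r _ 2) ?nnegrE ?Renorm_ge0 ?(ltW e0) // JD.
  have := infJ ((2^-1)%:C%C *: (u m + u n)).
  have := hu m; have := hu n; have := hn0 _ hm; have := hn0 _ hn.
  move: (n.+1%:R^-1) (m.+1%:R^-1) => p q; lra.
exists z => x; apply/eqP; rewrite -subr_eq0.
set a := g x z - phi x.
(* The right-hand side is [J (z + t x) - J z], nonnegative for every real [t] only if its linear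
   coefficient vanishes. *)
suff quad t : 0 <= t ^+ 2 * N x ^+ 2 + 2 * t * a.
  have D0 : 0 < N x ^+ 2 + 1 by rewrite ltr_wpDl ?sqr_ge0.
  (* The minimising [t] would be [- a / N x ^+ 2]; adding 1 covers [x = 0]. *)
  have := quad (- a / (N x ^+ 2 + 1)).
  have -> : (- a / (N x ^+ 2 + 1)) ^+ 2 * N x ^+ 2 + 2 * (- a / (N x ^+ 2 + 1)) * a
     = - (a ^+ 2 * (N x ^+ 2 + 2) / (N x ^+ 2 + 1) ^+ 2).
    by field; rewrite gt_eqF.
  rewrite oppr_ge0 pmulr_lle0 ?invr_gt0 ?exprn_gt0 // pmulr_lle0 ?ltr_wpDl ?sqr_ge0 //.
  by move=> h; rewrite -sqrf_eq0 eq_le h sqr_ge0.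
suff approx (e : R) : 0 < e -> 0 <= e + (t ^+ 2 * N x ^+ 2 + 2 * t * a).
  exact/ler_addgt0Pl.
move=> e0; pose d : R := e / (1 + 2 * `|t| * N x).
have C0 : 0 < 1 + 2 * `|t| * N x.
  by rewrite ltr_wpDr // !mulr_ge0 ?Renorm_ge0.
have d0 : 0 < d by rewrite divr_gt0.
have [n1 h1] := hz _ d0; have [n2 h2] := small _ d0.
pose n := maxn n1 n2.
have {}h1 := h1 n (leq_maxl _ _); have {}h2 := h2 n (leq_maxr _ _).
have := infJ (u n + t%:C%C *: x); have := hu n.
rewrite /J phiD phiZ (sqr_RenormD ipH) RenormZ cmod_real exprMn.
rewrite real_normK ?num_real // ReipZr => k1 k2.
have := cauchy_schwarz ipH x (u n - z); rewrite ReipDr ReipNr => k3.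
have k4 : 2 * t * (g x (u n) - g x z) <= 2 * `|t| * N x * d.
  apply: le_trans (ler_norm _) _; rewrite normrM normrM.
  rewrite (ger0_norm (_ : 0 <= 2)) // -!mulrA !ler_wpM2l //.
  apply: le_trans k3 _; apply: ler_wpM2l; first exact: Renorm_ge0.
  exact: ltW.
have k5 : e = d + 2 * `|t| * N x * d by rewrite /d; field; rewrite gt_eqF.
move: k1 k2 h2; rewrite (ReipC ip (u n) x) /a.
move: (n.+1%:R^-1) => p; lra.
Qed.

Lemma adjoint_exists T : bounded_op T ->
  exists2 S : {linear H -> H}, bounded_op S & forall x y, g x (S y) = g (T x) y.
Proof.
move=> bT; have T0 := opnorm_ge0 bT.
have rep y : exists z, forall x, g x z = g (T x) y.
  apply: (@riesz_representation (fun x => g (T x) y) (opnorm T * N y)).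
  - by move=> x x'; rewrite linearD ReipDl.
  - by move=> a x; rewrite linearZ /= ReipC ReipZr ReipC.
  move=> x; apply: le_trans (cauchy_schwarz ipH _ _) _.
  by rewrite mulrAC ler_wpM2r ?Renorm_ge0 //; exact: opnormP.
have [f hf] := choice rep.
have [|S SE] := @linear_pack _ _ f.
  (* Complex linearity is recovered from real parts by moving the scalar to the other argument as
     its conjugate. *)
  move=> c y y'; apply: Reip_inj => x.
  rewrite ReipDr !hf ReipDr; congr (_ + _).
  by rewrite -(conjCK c) -!ReipZ hf linearZ.
exists S => [|x y]; last by rewrite SE hf.
exists (opnorm T) => y; have [y0|y0] := eqVneq (N (S y)) 0.
  by rewrite y0 mulr_ge0 ?Renorm_ge0.
have Sy : 0 < N (S y) by rewrite lt_def y0 Renorm_ge0.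
rewrite -(ler_pM2l Sy) -expr2 (RenormE ipH) {2}SE hf.
apply: le_trans (ler_norm _) _; apply: le_trans (cauchy_schwarz ipH _ _) _.
rewrite mulrA (mulrC _ (opnorm T)).
by rewrite ler_wpM2r ?Renorm_ge0 //; exact: opnormP.
Qed.

(** The recursion [B |-> 1 + S B T], with [S] the adjoint, shifts the orbit sum by one step and adds
    the term [k = 0]. *)
Lemma gram_operator T n : bounded_op T ->
  exists2 B : {linear H -> H}, bounded_op B &
    forall x, g x (B x) = \sum_(k < n) N (iter k T x) ^+ 2.
Proof.
move=> bT; have [S bS hS] := adjoint_exists bT.
elim: n => [|n [B bB hB]].
  exists \0; first by exists 0 => x /=; rewrite mul0r Renorm0.
  by move=> x; rewrite big_ord0 /= linear0r.
exists (idfun \+ (S \o B \o T)).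
  have bC := bounded_comp (bounded_comp bS bB) bT.
  exists (1 + opnorm (S \o B \o T)) => x.
  rewrite mulrDl mul1r; apply: le_trans (RenormD _ _) _.
  by rewrite lerD2l; exact: (opnormP bC).
move=> x; rewrite /= ReipDr hS hB -(RenormE ipH) big_ord_recl; congr (_ + _).
by apply: eq_bigr => k _; rewrite -iterSr.
Qed.

(* [X = 1 + e B] for the Gram operator [B] of the orbit of length [M]: the
   telescoping difference [g x (B x) - g (S x) (B (S x))] is at least
   [3/4 * N x ^+ 2] and dominates the terms of order [e ^+ 2]. *)
Lemma similar_strict_contraction S M :
  (forall x, N (S x) <= N x) -> (forall x, N (iter M S x) <= 2^-1 * N x) ->
  exists X Y : {linear H -> H}, op_inverse X Y /\
    exists2 q : R, 0 <= q < 1 & forall x, N (X (S (Y x))) <= q * N x.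
Proof.
move=> bS hM.
have [|B bB hB] := @gram_operator S M.
  by exists 1 => x; rewrite mul1r.
pose b := opnorm B + 1.
have b1 : 1 <= b by rewrite lerDr opnorm_ge0.
have hb x : N (B x) <= b * N x.
  apply: le_trans (opnormP bB _) _.
  by rewrite ler_wpM2r ?Renorm_ge0 // lerDl.
(* Then [e * b ^+ 2 = 1/2] bounds the second-order term by [e / 2 * N x ^+ 2], and [b >= 1] gives
   [e * b <= 1/2], which makes [X] invertible. *)
pose e := (2 * b ^+ 2)^-1.
have b0 : 0 < b by lra.
have e0 : 0 < e by rewrite invr_gt0 mulr_gt0 ?exprn_gt0.
have eb2 : e * b ^+ 2 = 2^-1 by rewrite /e; field; rewrite gt_eqF.
have eb : e * b <= 2^-1 by rewrite -eb2 expr2 ler_pM2l // ler_peMl // ltW.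
have [||Y invX] := @neumann_invertible R H ((- e)%:C%C \*: B) (2^-1).
- by apply/andP; split; lra.
- move=> x /=; rewrite RenormZ cmod_real normrN gtr0_norm //.
  apply: le_trans (ler_wpM2l (ltW e0) (hb x)) _.
  by rewrite mulrA ler_wpM2r ?Renorm_ge0.
set X := (_ \- _) in invX.
have XE x : X x = x + e%:C%C *: B x by rewrite /X /= rmorphN scaleNr opprK.
have sqrX x : N (X x) ^+ 2 =
    N x ^+ 2 + 2 * e * \sum_(k < M) N (iter k S x) ^+ 2 + e ^+ 2 * N (B x) ^+ 2.
  rewrite XE (sqr_RenormD ipH) ReipZr hB RenormZ cmod_real exprMn gtr0_norm //; ring.
(* A decrease of [e * N x ^+ 2] becomes the factor [4 / 9] because [N (X x) <= 3 / 2 * N x]. *)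
have XS x : N (X (S x)) ^+ 2 <= (1 - e * 4 / 9) * N (X x) ^+ 2.
  have XB : N (X x) <= 3 / 2 * N x.
    rewrite XE; apply: le_trans (RenormD _ _) _; rewrite RenormZ cmod_real gtr0_norm //.
    have := ler_wpM2l (ltW e0) (hb x); have := ler_wpM2r (Renorm_ge0 x) eb; lra.
  have X2 : N (X x) ^+ 2 <= 9 / 4 * N x ^+ 2.
    have -> : 9 / 4 * N x ^+ 2 = (3 / 2 * N x) ^+ 2 by field.
    by rewrite lerXn2r ?nnegrE ?Renorm_ge0 ?mulr_ge0 ?Renorm_ge0 //; lra.
  (* Telescoping gains [2 * e * 3 / 4], and the second-order term loses at most [e / 2]. *)
  suff : N (X (S x)) ^+ 2 <= N (X x) ^+ 2 - e * N x ^+ 2.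
    have := ler_wpM2l (ltW e0) X2; lra.
  rewrite !sqrX.
  have tele : N x ^+ 2 + \sum_(k < M) N (iter k S (S x)) ^+ 2 =
      \sum_(k < M) N (iter k S x) ^+ 2 + N (iter M S x) ^+ 2.
    rewrite -[RHS](big_ord_recr M (fun k => N (iter k S x) ^+ 2)) big_ord_recl /=.
    by congr (_ + _); apply: eq_bigr => k _; rewrite -iterSr.
  have h1 : N (S x) ^+ 2 <= N x ^+ 2 by rewrite lerXn2r ?nnegrE ?Renorm_ge0.
  have h2 : N (iter M S x) ^+ 2 <= 1 / 4 * N x ^+ 2.
    have -> : 1 / 4 * N x ^+ 2 = (2^-1 * N x) ^+ 2 by field.
    by rewrite lerXn2r ?nnegrE ?Renorm_ge0 ?mulr_ge0 ?Renorm_ge0.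
  have h3 : e ^+ 2 * N (B (S x)) ^+ 2 <= e / 2 * N x ^+ 2.
    have -> : e / 2 * N x ^+ 2 = e ^+ 2 * (b * N x) ^+ 2.
      by rewrite -eb2; ring.
    apply: ler_wpM2l; first exact: sqr_ge0.
    rewrite lerXn2r ?nnegrE ?Renorm_ge0 ?mulr_ge0 ?Renorm_ge0 ?(ltW b0) //.
    by apply: le_trans (hb _) _; rewrite ler_wpM2l // ltW.
  have h4 : 0 <= e ^+ 2 * N (B x) ^+ 2 by rewrite mulr_ge0 ?sqr_ge0.
  have h5 : 2 * e * \sum_(k < M) N (iter k S (S x)) ^+ 2 <=
     2 * e * \sum_(k < M) N (iter k S x) ^+ 2 - 2 * e * (3 / 4 * N x ^+ 2).
    rewrite -mulrBr ler_wpM2l ?mulr_ge0 ?(ltW e0) //; lra.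
  lra.
have e2 : e <= 2^-1 by apply: le_trans eb; rewrite ler_peMr // ltW.
exists X, Y; split => //; exists (Num.sqrt (1 - e * 4 / 9)).
  rewrite sqrtr_ge0 /= -[ltRHS]sqrtr1 ltr_sqrt //; lra.
have [_ _ _ YX] := invX.
move=> x; rewrite -(@ler_pXn2r _ 2) ?nnegrE ?mulr_ge0 ?sqrtr_ge0 ?Renorm_ge0 //.
rewrite exprMn sqr_sqrtr; last by lra.
by rewrite -{2}(YX x); exact: XS.
Qed.

(** * The two implications *)

Lemma normaloid_of_similarity T : bounded_op T ->
  (forall X Y : {linear H -> H}, op_inverse X Y ->
    opnorm T <= opnorm (X \o T \o Y)) -> normaloid T.
Proof.
move=> bT hT; apply/eqP; rewrite eq_le spectral_radius_le_opnorm //= leNgt.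
apply/negP => lt; set r := opnorm T in lt.
have r0 : 0 < r := le_lt_trans (spectral_radius_ge0 bT) lt.
(* No point of modulus [r] is in the spectrum, as [r] exceeds the spectral radius. *)
have [|K K0 hK] := @circle_uniform_bound _ _ T r.
  move=> l lr; apply: contrapT => sl.
  by have := le_spectral_radius bT sl; rewrite lr leNgt lt.
have [M hM] := power_bound ipH r0 K0 (opnormP bT) hK.
pose S : {linear H -> H} := (r^-1)%:C%C \*: T.
have iterS k x : N (iter k S x) = r ^- k * N (iter k T x).
  have -> : iter k S x = (r ^- k)%:C%C *: iter k T x.
    elim: k => [|k IH]; first by rewrite invr1 scale1r.
    by rewrite !iterS IH /= linearZ /= scalerA -rmorphM -invfM -exprS.
  by rewrite RenormZ cmod_real ger0_norm // invr_ge0 exprn_ge0 // ltW.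
have [||X [Y [iXY [q /andP[q0 q1] hq]]]] := @similar_strict_contraction S M.
- move=> x; have := iterS 1%N x; rewrite expr1 /= => ->.
  by rewrite ler_pdivrMl //; exact: opnormP.
- move=> x; rewrite iterS ler_pdivrMl ?exprn_gt0 // mulrA (mulrC (r ^+ M)).
  exact: hM.
have := hT _ _ iXY; rewrite leNgt => /negP; apply.
apply: le_lt_trans (_ : r * q < r); last by rewrite gtr_pMr.
apply: opnorm_le => [|x]; first by rewrite mulr_ge0 // ltW.
have := hq x; rewrite /= (linearZ_LR X) RenormZ cmod_real ger0_norm
  ?invr_ge0 ?(ltW r0) //.
by rewrite ler_pdivrMl // mulrA.
Qed.

Lemma similarity_of_normaloid T : bounded_op T -> normaloid T ->
  forall X Y : {linear H -> H}, op_inverse X Y ->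
    opnorm T <= opnorm (X \o T \o Y).
Proof.
move=> bT nT X Y iXY; have [bX bY _ _] := iXY.
have bS : bounded_op (X \o T \o Y) by apply: bounded_comp => //; exact: bounded_comp.
rewrite -nT /spectral_radius.
(* The least upper bound property needs a nonempty set; an empty spectrum has radius 0. *)
have [->|/set0P e] := eqVneq [set cmod l | l in spectrum T]%classic set0.
  by rewrite sup0 opnorm_ge0.
apply: ge_sup => // _ [l sl <-]; apply: spectrum_le_opnorm => //.
exact: (similar_spectrum bT iXY).
Qed.

End Adjoint.

Unset Implicit Arguments.
Set Strict Implicit.
Set Printing Implicit Defensive.

Theorem corollary2p3 (R : realType) (H : completeNormedModType R[i])
    (ip : {dot H for Num.conj}) (ipH : induces_norm ip)
    (T : {linear H -> H}) (bT : bounded_op T) :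
  normaloid T <->
  (forall X Y : {linear H -> H}, op_inverse X Y ->
    opnorm T <= opnorm (X \o T \o Y)).
Proof.
split; first exact: similarity_of_normaloid.
exact: (normaloid_of_similarity ipH).
Qed.
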